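(* There exists $N_0$ such that for every integer $N\ge N_0$ the cyclic group $\mathbb{Z}_N=\mathbb{Z}/N\mathbb{Z}$ contains a Sidon set $S\subset\mathbb{Z}_N$ which is a basis of order $3$ in $\mathbb{Z}_N$, i.e. every $x\in\mathbb{Z}_N$ can be written as $x=s_1+s_2+s_3$ with $s_1,s_2,s_3\in S$.
   Context: A subset $S$ of an abelian group is a Sidon set if all the sums $a+a'$ of two (possibly equal) elements of $S$ are distinct up to order: $a+b=c+d$ with $a,b,c,d\in S$ implies $\{a,b\}=\{c,d\}$. *)

(* Defs.v *)
From mathcomp Require Import all_boot all_algebra.

Set Implicit Arguments.
Unset Strict Implicit.
Unset Printing Implicit Defensive.

Import GRing.Theory.
Local Open Scope ring_scope.

(* [:: a; b] =i [:: c; d] is the equality of sets {a, b} = {c, d}; sequences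
   are used because G need not be finite. *)
Definition sidon (G : zmodType) (S : {pred G}) : Prop :=
  forall a b c d : G, a \in S -> b \in S -> c \in S -> d \in S ->
    a + b = c + d -> [:: a; b] =i [:: c; d].

Definition basis_of_order3 (G : zmodType) (S : {pred G}) : Prop :=
  forall x : G, exists s1 s2 s3 : G,
    [/\ s1 \in S, s2 \in S, s3 \in S & x = s1 + s2 + s3].

(* Main.v *)
Require Import Defs.
From mathcomp Require Import all_boot all_algebra.
From mathcomp Require Import zify ring.

Set Implicit Arguments.
Unset Strict Implicit.
Unset Printing Implicit Defensive.

Import GRing.Theory.

(** The set is a random lift of a parabola to the cyclic group.

    Let p be a prime equal to sqrt N up to a logarithmic factor.  In F_p^2 the
    parabola of the points (x, x^2) is a Sidon set: x + y and x^2 + y^2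
    determine {x, y} ([parabola_sidon]).  Write numbers n < N / 2 as
    n = v + B * h with v < B / 2 and B a bounded multiple of p.  A sum of two
    such numbers, even read modulo N, determines the sum of the low digits and
    that of the high digits.  So choosing for each x one number n with v = x
    and h = x^2 modulo p always gives a Sidon set, whichever of the L lifts of
    (x, x^2) is chosen.  There is room for such digits with L polylogarithmic
    in N.

    For sums of three the freedom in the choice is what matters.  Every residue
    modulo N is represented by some V + B * W with V and W in the middle of the
    ranges of the threefold digit sums, and there every solution of
    x1 + x2 + x3 = V and x1^2 + x2^2 + x3^2 = W in F_p comes from suitable lifts
    ([exists_lift_triple]).  This system is a conic with at least p - 3 points,
    from which about p / 18 triples without common coordinates can be extracted
    ([disjoint_solution_triples]).  A random choice realises each of them
    independently with probability L^-3, hence it misses the given residue with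
    probability at most (1 - L^-3)^(p / 18), which is less than 1 / N.  Some
    choice therefore misses no residue ([exists_hitting]).

    The conic may be a single point when 3 W = V^2.  To avoid this, v is
    restricted to the residues modulo 183 of a perfect difference set D carrying
    weights, the points whose chosen v violates this being dropped, and h is
    lifted from x^2 - weight (v mod 183).  A sum of two
    elements of D determines the sum of their weights, so the Sidon property is
    kept.  But every residue modulo 183 is a sum of three elements of D in two
    ways with different total weights, and the two conics that result are not
    both degenerate ([weight_additive], [weight_two_triples]).

    The only fact needed about primes is that there is one between X / log X and
    X up to constants; it follows from the prime factorisation of a central
    binomial coefficient ([exists_prime_pow2]). *)

(** * Primes near a power of two *)

Lemma central_bin_step n :
  n.+1 * 'C(n.+1.*2, n.+1) = (n.*2.+1).*2 * 'C(n.*2, n).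
Proof.
have f0 : 0 < n`! by exact: fact_gt0.
have e1 := @bin_fact n.*2 n ltac:(lia).
have e2 := @bin_fact n.+1.*2 n.+1 ltac:(lia).
have e3 : n.*2 - n = n by lia.
have e4 : n.+1.*2 - n.+1 = n.+1 by lia.
rewrite e3 in e1; rewrite e4 in e2.
move: e2; rewrite doubleS !factS -e1.
move: f0; set F := n`!; set A := 'C(_, _); set B := 'C(_, _) => f0 e2.
apply/eqP; rewrite -(eqn_pmul2r (m := n.+1 * F * F)) ?muln_gt0 ?f0 //.
apply/eqP; nia.
Qed.

Lemma central_bin_lower n : 0 < n -> 4 ^ n <= n.*2 * 'C(n.*2, n).
Proof.
case: n => // n _; elim: n => [|n IH]; first by [].
rewrite expnS.
have := central_bin_step n.+1.
nia.
Qed.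

(** The exponent of p is the number of powers p^k with an odd floor of 2n / p^k,
    and only the powers p^k <= 2n count. *)
Lemma logn_central_bin p n : prime p -> 0 < n -> p ^ logn p 'C(n.*2, n) <= n.*2.
Proof.
move=> pr n0; have p1 := prime_gt1 pr.
have e1 := @bin_fact n.*2 n ltac:(lia).
have e3 : n.*2 - n = n by lia.
rewrite e3 in e1.
have := congr1 (logn p) e1.
rewrite !lognM ?muln_gt0 ?fact_gt0 ?bin_gt0 //; last by lia.
rewrite !logn_fact //.
have ext : \sum_(1 <= k < n.+1) n %/ p ^ k = \sum_(1 <= k < n.*2.+1) n %/ p ^ k.
  rewrite [RHS](big_cat_nat (n := n.+1)) //=; last by lia.
  rewrite [X in _ + X]big_nat_cond [X in _ + X]big1 ?addn0 //.
  move=> k /andP[/andP[nk _] _].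
  by rewrite divn_small // (ltn_trans _ (ltn_expl k p1)).
rewrite ext -big_split /= => e.
have le : \sum_(1 <= k < n.*2.+1) n.*2 %/ p ^ k <=
   \sum_(1 <= k < n.*2.+1) (n %/ p ^ k + n %/ p ^ k) + trunc_log p n.*2.
  have -> : trunc_log p n.*2 = \sum_(1 <= k < n.*2.+1) (k <= trunc_log p n.*2).
    have Tle : trunc_log p n.*2 <= n.*2.
      have n20 : 0 < n.*2 by lia.
      exact: leq_trans (ltnW (ltn_expl _ p1)) (trunc_logP p1 n20).
    rewrite (big_cat_nat (n := (trunc_log p n.*2).+1)) //=.
    rewrite big_nat_cond (eq_bigr (fun=> 1)); last first.
      by move=> i /andP[/andP[_]]; rewrite ltnS => ->.
    rewrite -big_nat_cond sum_nat_const_nat muln1.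
    rewrite big_nat_cond big1 ?addn0; first by lia.
    by move=> i /andP[/andP[]]; rewrite ltnNge => /negPf ->.
  rewrite -big_split /= leq_sum // => k _.
  have [kT|Tk] := leqP k (trunc_log p n.*2).
    have pk : 0 < p ^ k by rewrite expn_gt0 ltnW.
    have a := divn_eq n (p ^ k); have b := ltn_pmod n pk.
    rewrite -ltnS ltn_divLR //; nia.
  rewrite divn_small //.
  by rewrite ltnNge; apply/negP => /(trunc_log_max p1); lia.
apply: leq_trans (trunc_logP p1 (n := n.*2) _); last by lia.
by rewrite leq_exp2l //; lia.
Qed.

(** Otherwise the central binomial coefficient would be a product of at most m
    prime powers, each at most 2n, and fall below the bound of
    [central_bin_lower]. *)
Lemma exists_prime_above n m :
  0 < n -> n.*2 ^ m.+1 < 4 ^ n -> exists p, [/\ prime p, m < p & p <= n.*2].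
Proof.
move=> n0 lt.
have C0 : 0 < 'C(n.*2, n) by rewrite bin_gt0; lia.
have [/hasP[p]|/hasPn no] :=
    boolP (has (fun p => prime p && (m < p)) (iota 0 n.*2.+1)).
  by rewrite mem_iota => ? /andP[pr mp]; exists p; split=> //; lia.
suff le : 'C(n.*2, n) <= n.*2 ^ m.
  by have := central_bin_lower n0; rewrite expnS in lt; nia.
have e0 : 'C(n.*2, n) = \prod_(p <- primes 'C(n.*2, n)) p ^ logn p 'C(n.*2, n).
  by rewrite {1}(prod_prime_decomp C0) prime_decompE big_map.
rewrite e0.
have pP p : p \in primes 'C(n.*2, n) -> 0 < p <= m.
  rewrite mem_primes => /and3P[pr _ dv]; rewrite prime_gt0 //=.
  have := logn_central_bin pr n0.
  have : 0 < logn p 'C(n.*2, n) by rewrite logn_gt0 mem_primes pr C0.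
  case: (logn _ _) => // l _ le.
  have pn : p <= n.*2.
    by rewrite (leq_trans _ le) // expnS leq_pmulr // expn_gt0 prime_gt0.
  have := no p; rewrite mem_iota pr /= -leqNgt; apply; lia.
apply: (@leq_trans (\prod_(p <- primes 'C(n.*2, n)) n.*2)).
  rewrite big_seq_cond [X in _ <= X]big_seq_cond.
  elim/big_rec2: _ => // p A B /andP[pp _] AB; rewrite leq_mul //.
  by apply: logn_central_bin => //; move: pp; rewrite mem_primes => /andP[].
rewrite big_const_seq count_predT iter_muln_1 leq_pexp2l //; first by lia.
rewrite -(size_iota 1 m); apply: uniq_leq_size; first exact: primes_uniq.
by move=> p /pP; rewrite mem_iota; lia.
Qed.

Lemma exists_prime_pow2 k :
  0 < k -> exists p, [/\ prime p, p <= 2 ^ k & 2 ^ k <= k * p.+1].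
Proof.
case: k => // [[|k] _]; first by exists 2.
have := @exists_prime_above (2 ^ k.+1) ((2 ^ k.+2).-1 %/ k.+2).-1.
have -> : (2 ^ k.+1).*2 = 2 ^ k.+2 by rewrite (expnS 2 k.+1) mul2n.
have lt := ltn_expl k.+2 (isT : 1 < 2).
have d := divn_eq (2 ^ k.+2).-1 k.+2.
have r := ltn_pmod (2 ^ k.+2).-1 (isT : 0 < k.+2).
have q0 : 0 < (2 ^ k.+2).-1 %/ k.+2 by rewrite divn_gt0 //; lia.
rewrite prednK //.
case.
- by rewrite expn_gt0.
- have -> : 4 ^ 2 ^ k.+1 = 2 ^ 2 ^ k.+2 by rewrite (expnS 2 k.+1) (expnM 2 2).
  rewrite -expnM ltn_exp2l // mulnC; lia.
move=> p [pr mp pk]; exists p; split=> //; nia.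
Qed.

(** * Choice of the parameters *)

Lemma bernoulli q n : q ^ n * (q + n) <= q * q.+1 ^ n.
Proof.
elim: n => [|n IH]; first by rewrite !expn0; lia.
have := leq_mul IH (leqnn q.+1); rewrite !expnS.
by move: (q ^ n) (q.+1 ^ n) => x y; nia.
Qed.

(** This is the bound (1 - 1/Q)^Q <= 1/2. *)
Lemma double_pred_expn Q : 0 < Q -> 2 * (Q - 1) ^ Q <= Q ^ Q.
Proof.
case: Q => // -[|q] _ //; rewrite subn1 /=.
have := bernoulli q.+1 q.+2; rewrite [q.+1 * _]mulnC => le.
by rewrite -(leq_pmul2r (ltn0Sn q)); apply: leq_trans le; nia.
Qed.

Lemma leq_expl m n e : m <= n -> m ^ e <= n ^ e.
Proof. by case: e => // e; rewrite leq_exp2r. Qed.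

(** N events of probability (1 - 1/Q)^t cannot cover the whole space once t is
    at least Q log N. *)
Lemma union_bound N Q l t : 0 < Q -> N < 2 ^ l -> Q * l <= t ->
  N * (Q - 1) ^ t < Q ^ t.
Proof.
move=> Q0 Nl le.
have [q0|q0] := posnP ((Q - 1) ^ t); first by rewrite q0 muln0 expn_gt0 Q0.
apply: (@leq_trans (2 ^ l * (Q - 1) ^ t)); first by rewrite ltn_pmul2r.
rewrite -(subnKC le) !expnD mulnA leq_mul //; last by apply: leq_expl; lia.
by rewrite !expnM -expnMn leq_expl // double_pred_expn.
Qed.

Lemma poly_below_exp c : exists k0, forall k, k0 <= k -> c * k ^ 8 <= 2 ^ k.
Proof.
exists (16 * (c + 32)) => k lek.
set j := k %/ 16.
have kj : k <= 2 ^ 4 * 2 ^ j.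
  have := ltn_expl j (isT : 1 < 2); have := divn_eq k 16.
  have := ltn_pmod k (isT : 0 < 16).
  by rewrite -/j (_ : 2 ^ 4 = 16) //; lia.
have j16 : 16 * j <= k by have := divn_eq k 16; rewrite -/j; lia.
have cj : c + 32 <= j by rewrite /j leq_divRL // mulnC.
have k8 : k ^ 8 <= (2 ^ 4 * 2 ^ j) ^ 8 by apply: leq_expl.
apply: leq_trans (leq_mul (ltnW (ltn_expl c (isT : 1 < 2))) k8) _.
rewrite -[2 ^ 4 * _]expnD -expnM -expnD (leq_exp2l _ _ (isT : 1 < 2)).
lia.
Qed.

(** The moduli are fixed so that a low digit is less than 24 p m, the base is
    B = 48 p m, and a high digit is less than p J; J is the largest integer such
    that sums of two lifts stay below N, that is 2 B p J <= N.  As p is sqrt N up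
    to a logarithm, J is at most polylogarithmic, so the number (24 m J)^3 of
    triples of lifts is far smaller than the number t, of order p, of disjoint
    triples available. *)
Lemma exists_parameters m : 0 < m -> exists N0, forall N, N0 <= N ->
  exists p J t, [/\ prime p, 9 + m < p, 15 <= J,
    96 * m * p ^ 2 * J <= N < 96 * m * p ^ 2 * J.+1 &
    18 * t + 10 <= p /\
    N * ((24 * m * J) ^ 3 - 1) ^ t < ((24 * m * J) ^ 3) ^ t].
Proof.
move=> m0; set c := 96 * m * 16.
pose q0 := (24 * m * 256) ^ 3.
have [k0 k0P] := poly_below_exp (2 * (18 * q0 * (c + 4) + 20 + m)).
exists (c * 4 ^ k0.+1) => N leN.
have c0 : 0 < c by rewrite /c; lia.
pose k := trunc_log 4 (N %/ c).
have Nc : 0 < N %/ c.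
  by rewrite divn_gt0 // (leq_trans _ leN) // leq_pmulr // expn_gt0.
have /andP[klo khi] := @trunc_log_bounds 4 _ isT Nc; rewrite -/k in klo khi.
have kk0 : k0 < k by rewrite trunc_log_max // leq_divRL // mulnC.
have {}klo : c * 4 ^ k <= N by rewrite mulnC -leq_divRL.
have {}khi : N < c * 4 ^ k.+1 by rewrite mulnC -ltn_divLR.
have k1 : 0 < k by lia.
have big := k0P k (ltnW kk0).
have [p [pr plo phi]] := exists_prime_pow2 k1.
have p0 := prime_gt0 pr.
have p2k : 2 ^ k <= 2 * k * p by nia.
have sq : 4 ^ k = (2 ^ k) ^ 2 by rewrite -expnM mulnC expnM.
set a := 96 * m * p ^ 2.
have a0 : 0 < a by rewrite /a !muln_gt0 m0 p0.
pose J := N %/ a.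
have J15 : 15 <= J.
  rewrite /J leq_divRL //; apply: leq_trans klo; rewrite /a /c sq.
  have : p ^ 2 <= (2 ^ k) ^ 2 by rewrite leq_exp2r.
  by move=> /(leq_mul (leqnn (96 * m))); clear; lia.
have Jhi : J <= 256 * k ^ 2.
  rewrite -ltnS /J ltn_divLR //; apply: leq_trans khi _; rewrite expnS sq /a /c.
  have : (2 ^ k) ^ 2 <= (2 * k * p) ^ 2 by rewrite leq_exp2r.
  rewrite !expnMn (_ : 2 ^ 2 = 4) //.
  by move=> /(leq_mul (leqnn (96 * m))); clear; lia.
pose Q := (24 * m * J) ^ 3.
have Q0 : 0 < Q by rewrite /Q expn_gt0 !muln_gt0 m0 (leq_trans _ J15).
have Qhi : Q <= q0 * k ^ 6.
  rewrite /Q /q0 -[6]/(2 * 3) (expnM k 2 3) -expnMn; apply: leq_expl.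
  by rewrite -[24 * m * 256 * _]mulnA leq_mul.
pose l := c + 2 * k.+1.
have Nl : N < 2 ^ l.
  apply: leq_trans khi _; rewrite /l expnD (expnM 2 2) leq_mul //.
  exact/ltnW/ltn_expl.
have bound : 18 * (Q * l) + 10 + (10 + m) <= p.
  have {}big : (18 * q0 * (c + 4) + 20 + m) * (k ^ 6 * k) <= p.
    have := leq_trans big p2k.
    rewrite (_ : k ^ 8 = k ^ 6 * k * k); last by rewrite -!expnSr.
    move: (18 * q0 * (c + 4) + 20 + m) (k ^ 6) => B A le.
    by rewrite -(leq_pmul2l (m := 2 * k)) ?muln_gt0 //; move: le; clear; lia.
  have lk : l <= (c + 4) * k by rewrite /l; move: k1 c0; clear; clearbody c; nia.
  have := leq_mul Qhi lk.
  have : 0 < k ^ 6 * k by rewrite muln_gt0 expn_gt0 k1.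
  move: big; clear; clearbody q0 c l Q; move: (k ^ 6) => A.
  by nia.
exists p, J, (Q * l); split=> //.
- by move: bound; move: (Q * l) => t; clear; lia.
- by rewrite mulnC leq_divM /= mulnC -ltn_divLR.
- split; last exact: union_bound Nl _.
  by move: bound; move: (Q * l) => t; clear; lia.
Qed.

(** * Random functions meeting many patterns *)

Section Matching.
Variables X L : finType.
Implicit Types (f : {ffun X -> L}) (c : seq (X * L)).

Definition matches f c := all (fun e => f e.1 == e.2) c.

Definition override f c : {ffun X -> L} :=
  [ffun x => foldr (fun e y => if e.1 == x then e.2 else y) (f x) c].

Lemma override_out f c x : x \notin unzip1 c -> override f c x = f x.
Proof.
rewrite ffunE; elim: c => //= e c IH.
by rewrite inE negb_or eq_sym => /andP[/negPf -> /IH].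
Qed.

Lemma override_matches f c : uniq (unzip1 c) -> matches (override f c) c.
Proof.
move=> uc; apply/allP => e ec; rewrite ffunE; apply/eqP.
elim: c uc ec => //= d c IH /andP[dc uc]; rewrite inE => /orP[/eqP->|ec].
  by rewrite eqxx.
case: eqP => [de|_]; last exact: IH.
by rewrite de map_f in dc.
Qed.

Lemma matches_override f c d :
  ~~ has [in unzip1 c] (unzip1 d) -> matches (override f c) d = matches f d.
Proof.
move=> /hasPn cd; apply: eq_in_all => e ed.
by rewrite override_out // cd // map_f.
Qed.

(** A pattern [c] prescribes values at the points [unzip1 c]; the seq [E] lists
    patterns. *)
Definition avoiders (E : seq (seq (X * L))) :=
  [set f | all (fun c => ~~ matches f c) E].

(** Overwriting f on c so that it matches c does not affect the other patterns,
    whose domains are disjoint from that of c, and f is recovered from the result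
    together with its k old values on c. *)
Lemma card_avoiders_matching k c E :
  size c = k -> uniq (unzip1 (flatten (c :: E))) ->
  #|avoiders E| <= #|[set f in avoiders E | matches f c]| * #|L| ^ k.
Proof.
move=> szc; rewrite /= /unzip1 map_cat cat_uniq => /and3P[uc dE _].
pose vals f : k.-tuple L := tcast szc (map_tuple (fun e => f e.1) (in_tuple c)).
pose F f := (override f c, vals f).
rewrite -card_tuple -cardsT -cardsX.
have Finj : injective F.
  move=> f g [e1 e2]; apply/ffunP => x.
  have [xc|xc] := boolP (x \in unzip1 c); last first.
    by rewrite -(override_out f xc) -(override_out g xc) e1.
  have {e2} : map (fun e => f e.1) c = map (fun e => g e.1) c.
    have := congr1 (@tval k L) e2.
    by rewrite /vals !val_tcast.
  case/mapP: xc => e ec -> /eq_in_map; exact.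
rewrite -(card_imset _ Finj) subset_leq_card //.
apply/subsetP => _ /imsetP[f fE ->].
rewrite !inE /= andbT override_matches // andbT.
move: fE; rewrite inE => /allP fE; apply/allP => d dE'.
rewrite matches_override ?fE //.
apply: contra dE => /hasP[x xd xc]; apply/hasP; exists x => //.
rewrite map_flatten; apply/flattenP; exists (unzip1 d) => //.
exact: (map_f (map fst)).
Qed.

(** Disjoint patterns are independent events of probability L^-k for a uniformly
    random function; this is the resulting product bound with denominators
    cleared. *)
Lemma card_avoiders k E :
  (forall c, c \in E -> size c = k) -> uniq (unzip1 (flatten E)) ->
  #|avoiders E| * (#|L| ^ k) ^ size E
    <= #|{ffun X -> L}| * (#|L| ^ k - 1) ^ size E.
Proof.
elim: E => [|c E IH] szE uE; first by rewrite !muln1 max_card.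
have szc : size c = k by apply: szE; rewrite inE eqxx.
have le := card_avoiders_matching szc uE.
have {}IH : #|avoiders E| * (#|L| ^ k) ^ size E
    <= #|{ffun X -> L}| * (#|L| ^ k - 1) ^ size E.
  apply: IH => [d dE|]; first by apply: szE; rewrite inE dE orbT.
  by move: uE; rewrite /= /unzip1 map_cat cat_uniq => /and3P[].
have split : #|avoiders E| =
    #|[set f in avoiders E | matches f c]| + #|avoiders (c :: E)|.
  rewrite -(cardsID [set f | matches f c] (avoiders E)); congr (_ + _).
    by apply: eq_card => f; rewrite !inE.
  by apply: eq_card => f; rewrite !inE /=.
rewrite /= !expnS.
move: split le IH; set a := #|avoiders E|; set m := #|[set f in _ | _]|.
set a' := #|avoiders (c :: E)|; set Q := #|L| ^ k; set s := size E => ea le IH.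
have le' : a' * Q <= a * (Q - 1) by nia.
apply: (@leq_trans ((a * Q ^ s) * (Q - 1))); first by nia.
by rewrite [(Q - 1) * _]mulnC mulnA leq_mul2r IH orbT.
Qed.

Lemma exists_hitting (Y : finType) (E : Y -> seq (seq (X * L))) k t :
    0 < #|L| ->
    (forall y c, c \in E y -> size c = k) ->
    (forall y, uniq (unzip1 (flatten (E y)))) -> (forall y, size (E y) = t) ->
    #|Y| * (#|L| ^ k - 1) ^ t < (#|L| ^ k) ^ t ->
  exists f, forall y, exists2 c, c \in E y & matches f c.
Proof.
move=> L0 szE uE tE lt_bad.
have A0 : 0 < #|{ffun X -> L}| by rewrite card_ffun expn_gt0 L0.
set Q := #|L| ^ k in lt_bad *.
have bad_le : #|\bigcup_y avoiders (E y)| <= \sum_y #|avoiders (E y)|.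
  elim/big_rec2: _ => [|y B n _ IH]; first by rewrite cards0.
  by rewrite (leq_trans (leq_card_setU _ _)) // leq_add2l.
have : #|\bigcup_y avoiders (E y)| < #|{ffun X -> L}|.
  apply: leq_ltn_trans bad_le _.
  have Qt : 0 < Q ^ t by rewrite !expn_gt0 L0.
  rewrite -(ltn_pmul2r Qt).
  apply: (@leq_ltn_trans (#|{ffun X -> L}| * (#|Y| * (Q - 1) ^ t))).
    rewrite big_distrl /=.
    apply: (@leq_trans (\sum_(y : Y) #|{ffun X -> L}| * (Q - 1) ^ t)).
      by apply: leq_sum => y _; rewrite -(tE y) card_avoiders //; apply: szE.
    by rewrite sum_nat_const mulnCA.
  by rewrite ltn_pmul2l.
rewrite -cardsT => lt.
have /subsetPn[f _ fbad] :
    ~~ ([set: {ffun X -> L}] \subset \bigcup_y avoiders (E y)).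
  by apply/negP => /subset_leq_card; rewrite leqNgt lt.
exists f => y; apply/hasP; apply: contraR fbad => nh.
by apply/bigcupP; exists y => //; rewrite inE all_predC.
Qed.

End Matching.

(** * Weighted difference sets *)

Section WeightedResidues.
Variables (m : nat) (D : seq nat) (w : nat -> nat).

Definition additive_weight := forall a b c d,
  a \in D -> b \in D -> c \in D -> d \in D ->
  a + b = c + d %[mod m] -> w a + w b = w c + w d.

Definition triple_of_sum r (t : nat * nat * nat) :=
  let: (a, b, c) := t in
  [&& a \in D, b \in D, c \in D & a + b + c == r %[mod m]].

Definition triple_weight (t : nat * nat * nat) := w t.1.1 + w t.1.2 + w t.2.

Definition two_triple_weights := forall r, exists t t',
  [/\ triple_of_sum r t, triple_of_sum r t' & triple_weight t != triple_weight t'].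

Let pairs := [seq ((a + b) %% m, w a + w b) | a <- D, b <- D].
Let triples :=
  [seq ((a + e.1) %% m, w a + e.2) | a <- D, e <- undup pairs].

Definition additive_weight_check :=
  all (fun s => all (fun t => (s.1 == t.1) ==> (s.2 == t.2)) pairs) pairs.

(** Collecting the weights of the triples of sum r in one pass keeps the check
    linear in the number of triples for each r. *)
Definition two_triple_weights_check :=
  all (fun r => ~~ constant [seq s.2 | s <- triples & s.1 == r]) (iota 0 m).

Lemma additive_weightP : additive_weight_check -> additive_weight.
Proof.
have inS a b : a \in D -> b \in D -> ((a + b) %% m, w a + w b) \in pairs.
  by move=> aD bD; apply/allpairsP; exists (a, b).
move=> chk a b c d aD bD cD dD e.
have /implyP := allP (allP chk _ (inS _ _ aD bD)) _ (inS _ _ cD dD).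
by move=> H; apply/eqP/H/eqP.
Qed.

Lemma two_triple_weightsP :
  0 < m -> two_triple_weights_check -> two_triple_weights.
Proof.
have tripleP s : s \in triples ->
    exists2 t, triple_of_sum s.1 t & s.2 = triple_weight t.
  case/allpairsP => -[a e] /= [aD]; rewrite mem_undup.
  move=> /allpairsP[[b c] /= [bD cD ->]] ->.
  exists (a, b, c); last by rewrite /triple_weight /= addnA.
  by rewrite /= aD bD cD modn_mod modnDmr addnA eqxx.
move=> m0 chk r.
have : r %% m \in iota 0 m by rewrite mem_iota ltn_pmod.
move=> /(allP chk).
case E : [seq _ | _ <- _ & _] => [|k ks] //= /allPn[k' k's /eqP ne].
have memE k0 : k0 \in k :: ks ->
    exists2 t, triple_of_sum (r %% m) t & k0 = triple_weight t.
  rewrite -E => /mapP[s]; rewrite mem_filter.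
  move=> /andP[/eqP <- /tripleP[t ts es]] ->.
  by exists t.
have [t ts kt] := memE k (mem_head _ _).
have [t' ts' kt'] : exists2 t, triple_of_sum (r %% m) t & k' = triple_weight t.
  by apply: memE; rewrite inE k's orbT.
exists t, t'; move: ts ts' ne; rewrite kt kt' /triple_of_sum.
case: t t' {kt kt'} => [[? ?] ?] [[? ?] ?]; rewrite modn_mod => -> -> /eqP.
by rewrite eq_sym.
Qed.
End WeightedResidues.

(** The 14 residues modulo 183 form the perfect difference set of the projective
    plane of order 13. *)
Definition singer : seq nat :=
  [:: 0; 1; 3; 16; 23; 28; 42; 76; 82; 86; 119; 137; 154; 175].

(** Found by search: some residues modulo 183 are sums of only two triples from
    [singer], and the total weights of these two have to differ. *)
Definition weight r :=
  nth 0 [:: 1; 0; 2; 0; 0; 1; 2; 3; 3; 3; 0; 0; 3; 3] (index r singer).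

Lemma weight_additive : additive_weight 183 singer weight.
Proof.
have chk : additive_weight_check 183 singer weight by vm_compute.
exact: (additive_weightP chk).
Qed.

Lemma weight_two_triples : two_triple_weights 183 singer weight.
Proof.
have chk : two_triple_weights_check 183 singer weight by vm_compute.
exact: (@two_triple_weightsP 183 singer weight isT chk).
Qed.

Local Open Scope ring_scope.

(** * Points of a conic over a finite field *)

Section Conic.
Variable F : finFieldType.
Hypotheses (F2 : 2 != 0 :> F) (F3 : 3 != 0 :> F).

Lemma card_quadratic_roots (a b c : F) :
  a != 0 -> (#|[set x : F | a * x ^+ 2 + b * x + c == 0]%R| <= 2)%N.
Proof.
move=> a0; set R := [set _ | _]; have [->|[r rR]] := set_0Vmem R.
  by rewrite cards0.
apply: (@leq_trans #|[set r; - b / a - r]|); last by rewrite cards2; case: eqP.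
apply/subset_leq_card/subsetP => x; rewrite !inE => /eqP xR.
move: rR; rewrite inE => /eqP rR.
have : (x - r) * (x - (- b / a - r)) = 0.
  have : a * ((x - r) * (x - (- b / a - r))) = 0.
    have -> : a * ((x - r) * (x - (- b / a - r))) =
      (a * x ^+ 2 + b * x + c) - (a * r ^+ 2 + b * r + c) by field.
    by rewrite xR rR subrr.
  by move/eqP; rewrite mulf_eq0 (negPf a0) => /eqP.
by move/eqP; rewrite mulf_eq0 !subr_eq0.
Qed.

(** At most two elements share a square, and 0 is the square of 0 only. *)
Lemma card_squares : (#|F| < 2 * #|[set x ^+ 2 | x : F]%R|)%N.
Proof.
set A := [set _ | _ in _].
have A0 : 0 \in A by apply/imsetP; exists 0; rewrite ?expr0n.
have -> : #|F| = (\sum_(y in A) #|[set x : F | x ^+ 2 == y]%R|)%N.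
  rewrite -sum1_card (partition_big_imset (fun x : F => x ^+ 2)) /=.
  by apply: eq_bigr => y _; rewrite sum1dep_card.
have c0 : #|[set x : F | x ^+ 2 == 0]%R| = 1%N.
  rewrite (_ : [set _ | _] = [set 0]) ?cards1 //.
  by apply/setP => x; rewrite !inE expf_eq0.
rewrite (bigD1 0) //= c0 (cardsD1 0 A) A0 mulnDr muln1 -addn1 addnAC leq_add2l.
rewrite -sum1_card big_distrr /= (eq_bigl (fun y => y \in A :\ 0)); last first.
  by move=> y; rewrite !inE andbC.
apply: leq_sum => y _; rewrite muln1.
have := @card_quadratic_roots 1 0 (- y) (oner_neq0 _).
rewrite (_ : [set x | _] = [set x | x ^+ 2 == y]) //.
by apply/setP => x; rewrite !inE mul1r mul0r addr0 subr_eq0.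
Qed.

(** Completing the square, 4k = (2x + y)^2 + 3y^2: the squares and the values
    4k - 3y^2 both fill more than half of the field, so they meet. *)
Lemma exists_norm_form (k : F) : exists x y, x ^+ 2 + x * y + y ^+ 2 = k.
Proof.
set A := [set x ^+ 2 | x : F]; set C := [set 4 * k - 3 * s | s in A].
have cC : #|C| = #|A|.
  by rewrite card_imset // => s s' /addrI/oppr_inj/(mulfI F3).
have : (0 < #|A :&: C|)%N.
  have := cardsUI A C; have := card_squares; rewrite -/A cC.
  have : (#|A :|: C| <= #|F|)%N by rewrite max_card.
  lia.
rewrite card_gt0 => /set0Pn[z]; rewrite inE => /andP[/imsetP[x _ zx]].
case/imsetP => s /imsetP[y _ sy] zs.
exists ((x - y) / 2), y.
have e : x ^+ 2 = 4 * k - 3 * y ^+ 2 by rewrite -zx -sy.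
have -> : ((x - y) / 2) ^+ 2 + (x - y) / 2 * y + y ^+ 2
    = (x ^+ 2 + 3 * y ^+ 2) / 4.
  by field; rewrite (_ : 4 = 2 * 2) ?mulf_neq0 //; ring.
rewrite e; field.
by rewrite (_ : 4 = 2 * 2) ?mulf_neq0 //; ring.
Qed.

(** The lines through one point (a, b) of the conic parametrise the others by the
    slope t.  The slopes to discard are the roots of a polynomial of degree 3:
    those of directions at infinity and that of the tangent at (a, b). *)
Lemma card_norm_form (k : F) : k != 0 ->
  (#|F| <= #|[set z : F * F | z.1 ^+ 2 + z.1 * z.2 + z.2 ^+ 2 == k]%R| + 3)%N.
Proof.
move=> k0; have [a [b ab]] := exists_norm_form k.
set M := [set _ | _].
set al := 2 * a + b; set be := a + 2 * b.
pose P : {poly F} := (1 + 'X + 'X^2) * (al%:P + be *: 'X).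
pose s t := - (al + be * t) / (1 + t + t ^+ 2).
pose g t := (a + s t, b + t * s t).
have albe : (al != 0) || (be != 0).
  rewrite -negb_and; apply: contra k0 => /andP[/eqP al0 /eqP be0].
  have k3 : 3 * k = 0.
    have -> : 3 * k = al ^+ 2 - al * be + be ^+ 2 by rewrite -ab /al /be; ring.
    by rewrite al0 be0; ring.
  by move/eqP: k3; rewrite mulf_eq0 (negPf F3).
have P0 : P != 0.
  rewrite mulf_neq0 //.
    apply/eqP => /(congr1 (fun q : {poly F} => q`_0)).
    rewrite !coefD coef1 coefX coefXn coef0 /= !addr0 => /eqP.
    by rewrite oner_eq0.
  apply/eqP => e; move: albe.
  have := congr1 (fun q : {poly F} => q`_0) e.
  have := congr1 (fun q : {poly F} => q`_1) e.
  rewrite !coefD !coefZ !coefC !coefX /= mulr0 mulr1 addr0 add0r => -> ->.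
  by rewrite eqxx.
have szP : (size P <= 4)%N.
  rewrite (leq_trans (size_polyMleq _ _)) //.
  have s1 : (size (1 + 'X + 'X^2 : {poly F})%R <= 3)%N.
    rewrite (leq_trans (size_polyD _ _)) // geq_max size_polyXn andbT.
    by rewrite (leq_trans (size_polyD _ _)) // geq_max size_polyX size_poly1.
  have s2 : (size (al%:P + be *: 'X)%R <= 2)%N.
    rewrite (leq_trans (size_polyD _ _)) // geq_max (leq_trans (size_polyC_leq1 _)) //.
    by rewrite (leq_trans (size_scale_leq _ _)) // size_polyX.
  lia.
have PE t : P.[t] = (1 + t + t ^+ 2) * (al + be * t) by rewrite !hornerE.
set T := [set t | P.[t] != 0].
have cT : (#|F| <= #|T| + 3)%N.
  have -> : #|T| = (#|F| - #|[set t | root P t]|)%N.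
    rewrite -(cardsC [set t | root P t]) addKn; apply: eq_card => t.
    by rewrite !inE.
  have : (#|[set t | root P t]| < size P)%N.
    rewrite cardE max_poly_roots ?enum_uniq //.
    by apply/allP => t; rewrite mem_enum inE.
  lia.
apply: leq_trans cT _; rewrite leq_add2r.
have TP t : t \in T -> (1 + t + t ^+ 2 != 0) /\ (al + be * t != 0).
  by rewrite inE PE mulf_eq0 negb_or => /andP.
rewrite -(card_in_imset (f := g)).
  apply/subset_leq_card/subsetP => _ /imsetP[t /TP[t1 t2] ->].
  rewrite inE /=; apply/eqP; rewrite -ab /s /al /be; field.
  exact: t1.
move=> t t' /TP[t1 t2] /TP[t1' t2'] [/addrI e /addrI]; rewrite -e.
apply: mulIf; by rewrite /s mulf_neq0 ?oppr_eq0 ?invr_eq0.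
Qed.

Section Triples.
Variables (u v : F).
Hypothesis nondegenerate : 3 * v != u ^+ 2.

Definition solutions :=
  [set z : F * F | z.1 ^+ 2 + z.2 ^+ 2 + (u - z.1 - z.2) ^+ 2 == v].

(** Translating by the centre (u/3, u/3, u/3) turns the system into the norm form
    with a nonzero right-hand side. *)
Lemma card_solutions : (#|F| <= #|solutions| + 3)%N.
Proof.
pose k := (v - u ^+ 2 / 3) / 2.
have k0 : k != 0.
  rewrite mulf_neq0 ?invr_eq0 //; apply: contra nondegenerate => /eqP e.
  have -> : 3 * v = 3 * (v - u ^+ 2 / 3) + u ^+ 2 by field.
  by rewrite e mulr0 add0r.
apply: (leq_trans (card_norm_form k0)); rewrite leq_add2r.
pose g (z : F * F) := (z.1 + u / 3, z.2 + u / 3).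
have ginj : injective g.
  by move=> [a b] [c d] [] /addIr e /addIr e'; rewrite e e'.
rewrite -(card_imset _ ginj).
apply/subset_leq_card/subsetP => _ /imsetP[[a b] abN ->].
move: abN; rewrite !inE /= => /eqP e; apply/eqP.
transitivity (2 * (a ^+ 2 + a * b + b ^+ 2) + u ^+ 2 / 3); first by field.
by rewrite e /k; field; apply/andP.
Qed.

Lemma card_solutions_quadratic (S : {set F * F}) (f : F * F -> F) (a b c : F) :
    a != 0 -> {in S &, injective f} ->
    (forall z, z \in S -> a * f z ^+ 2 + b * f z + c = 0) ->
  (#|S| <= 2)%N.
Proof.
move=> a0 finj fS; rewrite -(card_in_imset finj).
apply: leq_trans (card_quadratic_roots b c a0).
apply/subset_leq_card/subsetP => _ /imsetP[z zS ->].
by rewrite inE fS.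
Qed.

Definition hit (e : F) :=
  [set z in solutions | e \in [:: z.1; z.2; u - z.1 - z.2]].

(** Once one coordinate is fixed, each of the other two is a root of a
    quadratic polynomial. *)
Lemma card_hit e : (#|hit e| <= 6)%N.
Proof.
have -> : hit e =
    [set z in solutions | z.1 == e] :|: [set z in solutions | z.2 == e]
     :|: [set z in solutions | u - z.1 - z.2 == e].
  by apply/setP => z; rewrite !inE -!andb_orr -orbA ![e == _]eq_sym.
pose c := (u - e) ^+ 2 + e ^+ 2 - v.
apply: leq_trans (leq_card_setU _ _) _; apply: (@leq_add _ _ 4 2).
  apply: leq_trans (leq_card_setU _ _) _; apply: (@leq_add _ _ 2 2).
    apply: (@card_solutions_quadratic _ snd 2 (- 2 * (u - e)) c) => //.
      move=> [x y] [x' y']; rewrite !inE /= => /andP[_ /eqP->] /andP[_ /eqP->].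
      by move->.
    move=> [x y]; rewrite !inE /c /= => /andP[/eqP <- /eqP ->]; ring.
  apply: (@card_solutions_quadratic _ fst 2 (- 2 * (u - e)) c) => //.
    move=> [x y] [x' y']; rewrite !inE /= => /andP[_ /eqP->] /andP[_ /eqP->].
    by move->.
  move=> [x y]; rewrite !inE /c /= => /andP[/eqP <- /eqP ->]; ring.
apply: (@card_solutions_quadratic _ fst 2 (- 2 * (u - e)) c) => //.
  move=> [x y] [x' y']; rewrite !inE /= => /andP[_ /eqP<-] /andP[_ /eqP e'] xx.
  by move: e'; rewrite xx => /addrI/oppr_inj ->.
move=> [x y]; rewrite !inE /c /= => /andP[/eqP <- /eqP <-]; ring.
Qed.

Lemma card_repeated :
  (#|[set z in solutions | ~~ uniq [:: z.1; z.2; u - z.1 - z.2]]%R| <= 6)%N.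
Proof.
have F6 : 6 != 0 :> F by rewrite (_ : 6 = 2 * 3) ?mulf_neq0 //; ring.
have -> : [set z in solutions | ~~ uniq [:: z.1; z.2; u - z.1 - z.2]] =
  [set z in solutions | z.1 == z.2] :|: [set z in solutions | z.1 == u - z.1 - z.2]
   :|: [set z in solutions | z.2 == u - z.1 - z.2].
  apply/setP => z; rewrite !inE -!andb_orr /= !inE andbT negb_and !negbK.
  by rewrite -orbA.
have solve a b : a = u - a - b -> b = u - 2 * a.
  by move=> e; have -> : b = u - a - (u - a - b) by [ring]; rewrite -e; ring.
have solve' a b : b = u - a - b -> a = u - 2 * b.
  by rewrite addrAC; apply: solve.
pose c := u ^+ 2 - v.
apply: leq_trans (leq_card_setU _ _) _; apply: (@leq_add _ _ 4 2).
  apply: leq_trans (leq_card_setU _ _) _; apply: (@leq_add _ _ 2 2).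
    apply: (@card_solutions_quadratic _ fst 6 (- 4 * u) c) => //.
      move=> [x y] [x' y']; rewrite !inE /= => /andP[_ /eqP<-] /andP[_ /eqP<-].
      by move->.
    move=> [x y]; rewrite !inE /c /= => /andP[/eqP <- /eqP <-]; ring.
  apply: (@card_solutions_quadratic _ fst 6 (- 4 * u) c) => //.
    move=> [x y] [x' y']; rewrite !inE /= => /andP[_ /eqP e] /andP[_ /eqP e'] xx.
    by rewrite (solve _ _ e) (solve _ _ e') xx.
  move=> [x y]; rewrite !inE /c /= => /andP[/eqP <- /eqP /solve ->]; ring.
apply: (@card_solutions_quadratic _ snd 6 (- 4 * u) c) => //.
  move=> [x y] [x' y']; rewrite !inE /= => /andP[_ /eqP e] /andP[_ /eqP e'] yy.
  by rewrite (solve' _ _ e) (solve' _ _ e') yy.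
move=> [x y]; rewrite !inE /c /= => /andP[/eqP <- /eqP /solve' ->]; ring.
Qed.

(** Greedy extraction: the 3 t coordinates already used exclude at most 18 t
    solutions, and at most 6 solutions have a repeated coordinate. *)
Lemma disjoint_solution_triples t : (18 * t + 10 <= #|F|)%N ->
  exists T : seq (seq F), [/\ size T = t, uniq (flatten T) & forall s, s \in T ->
    exists x y z,
      [/\ s = [:: x; y; z], x + y + z = u & x ^+ 2 + y ^+ 2 + z ^+ 2 = v]].
Proof.
elim: t => [|t IH] lt; first by exists [::]; split.
have [|T [sT uT TP]] := IH; first by lia.
pose E := flatten T.
have sE : size E = (3 * t)%N.
  rewrite size_flatten /shape -sT {sT uT E}; elim: T TP => //= s T IHT TP.
  rewrite IHT => [|s' s'T]; last by apply: TP; rewrite inE s'T orbT.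
  have [x [y [z [-> _ _]]]] := TP s (mem_head _ _).
  by rewrite /=; lia.
pose B := (\bigcup_(e in [set e in E]) hit e) :|:
  [set z in solutions | ~~ uniq [:: z.1; z.2; u - z.1 - z.2]].
have cB : (#|B| <= 18 * t + 6)%N.
  apply: leq_trans (leq_card_setU _ _) _; apply: leq_add card_repeated.
  apply: (@leq_trans (\sum_(e in [set e in E]) 6)).
    elim/big_rec2: _ => [|e n S _ IHS]; first by rewrite cards0.
    by rewrite (leq_trans (leq_card_setU _ _)) // leq_add ?card_hit.
  rewrite sum_nat_const.
  have : (#|[set e in E]| <= size E)%N by rewrite cardsE card_size.
  by rewrite sE; lia.
have /subsetPn[[x y] xyS] : ~~ (solutions \subset B).
  apply/negP => /subset_leq_card; have := card_solutions; lia.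
rewrite inE negb_or !inE /=.
pose z := u - x - y; rewrite -/z.
move: (xyS); rewrite inE /= -/z => /eqP xyz; rewrite xyz eqxx /= negbK.
move=> /andP[nhit un].
exists ([:: x; y; z] :: T); split; first by rewrite /= sT.
  rewrite (_ : flatten _ = [:: x; y; z] ++ E) // cat_uniq uT andbT.
  apply/andP; split; first exact: un.
  apply/hasPn => e eE; apply: contra nhit => exyz.
  apply/bigcupP; exists e; rewrite ?inE //= -/z xyz eqxx.
  by rewrite !inE in exyz *.
move=> s; rewrite inE => /orP[/eqP->|/TP//].
by exists x, y, z; split; rewrite ?xyz // /z; ring.
Qed.
End Triples.
End Conic.

(** * Lifts of the parabola to residues modulo N *)

Lemma exists_residue_in_window (M c lo : nat) : (0 < M)%N ->
  exists2 v, (lo <= v < lo + M)%N & v = c %[mod M].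
Proof.
move=> M0; exists (lo + (c + (M * lo - lo)) %% M)%N.
  by rewrite leq_addr ltn_add2l ltn_pmod.
rewrite modnDmr addnCA subnKC ?leq_pmull // -modnDmr.
by rewrite mulnC modnMl addn0.
Qed.

Lemma eq_digits (M a b c d : nat) : (a < M)%N -> (c < M)%N ->
  (a + M * b = c + M * d)%N -> a = c /\ b = d.
Proof.
move=> aM cM e; have M0 : (0 < M)%N by apply: leq_trans aM.
have := congr1 (fun n => (n %/ M)%N) e; have := congr1 (modn^~ M) e.
rewrite !(addnC _ (M * _)%N) ![(M * _)%N]mulnC !modnMDl !divnMDl //.
by rewrite !modn_small // !divn_small // !addn0.
Qed.

Lemma parabola_sidon (F : fieldType) (x y x' y' : F) : 2 != 0 :> F ->
  x + y = x' + y' -> x ^+ 2 + y ^+ 2 = x' ^+ 2 + y' ^+ 2 ->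
  (x = x' /\ y = y') \/ (x = y' /\ y = x').
Proof.
move=> F2 e1 e2.
have ey : y = x' + y' - x by rewrite -e1; ring.
have : 2 * ((x - x') * (x - y')) = 0.
  have -> : 2 * ((x - x') * (x - y')) =
    (x ^+ 2 + (x' + y' - x) ^+ 2) - (x' ^+ 2 + y' ^+ 2) by ring.
  by rewrite -ey e2 subrr.
move/eqP; rewrite !mulf_eq0 (negPf F2) /= !subr_eq0 => /orP[]/eqP ex.
  by left; rewrite ey ex; split=> //; ring.
by right; rewrite ey ex; split=> //; ring.
Qed.

(** If two summands of V are close to V / 3, so is the third. *)
Lemma third_near_third V P a b :
  (V %/ 3 <= a < V %/ 3 + P)%N -> (V %/ 3 <= b < V %/ 3 + P)%N ->
  [/\ (3 * a < V + 3 * P)%N, (3 * b < V + 3 * P)%N,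
      (3 * (a + b) <= 2 * V + 6 * P)%N & (3 * (V - a - b) <= V + 6)%N].
Proof.
by have := divn_eq V 3; have := ltn_pmod V (isT : 0 < 3)%N; split; lia.
Qed.

Lemma map_preimage (A B : eqType) (f : A -> B) (Q : A -> Prop) (s : seq B) :
    (forall b, b \in s -> exists2 a, f a = b & Q a) ->
  exists2 r, map f r = s & forall a, a \in r -> Q a.
Proof.
elim: s => [|b s IH] sP; first by exists [::].
have [|r rs rQ] := IH; first by move=> b' b's; apply: sP; rewrite inE b's orbT.
have [a ab aQ] := sP b (mem_head _ _).
exists (a :: r); first by rewrite /= ab rs.
by move=> a'; rewrite inE => /orP[/eqP->|/rQ].
Qed.

Section Lifts.
Variables (p m J N : nat) (D : seq nat) (w : nat -> nat).
Hypotheses (pr : prime p) (p3 : (3 < p)%N) (m0 : (0 < m)%N) (pm : coprime p m).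
Hypotheses (wD : additive_weight m D w) (Dm : forall a, a \in D -> (a < m)%N).

Let B := (48 * (p * m))%N.

(** A lift of (x, x^2 - weight) to two digits is given by the multiples of p
    added to its coordinates. *)
Definition lift_index := ('I_(24 * m) * 'I_J)%type.
Definition low (x : 'F_p) (l : lift_index) : nat := (x + p * l.1)%N.
Definition high (x : 'F_p) (l : lift_index) : nat :=
  ((x ^+ 2 - (w (low x l %% m))%:R : 'F_p)%R + p * l.2)%N.
Definition point x l := (low x l + B * high x l)%N.
Definition allowed x l := (low x l %% m)%N \in D.

Let p0 : (0 < p)%N := prime_gt0 pr.

Lemma Fp_ltn (x : 'F_p) : (x < p)%N.
Proof. by have := ltn_ord x; rewrite [X in (_ < X)%N](Fp_cast pr). Qed.

Lemma natr_Fp_eq0 n : (n%:R == 0 :> 'F_p) = (p %| n)%N.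
Proof. by rewrite (dvdn_pcharf (pchar_Fp pr)). Qed.

Lemma natr_FpD (x : 'F_p) n : (x + p * n)%N%:R = x.
Proof. by rewrite natrD natrM (pcharf0 (pchar_Fp pr)) mul0r addr0 natr_Zp. Qed.

Lemma eq_natF (a b : nat) : a = b -> a%:R = b%:R :> 'F_p.
Proof. by move->. Qed.

Lemma eq_natFD (a b c d : nat) : (a + b = c + d)%N ->
  a%:R + b%:R = c%:R + d%:R :> 'F_p.
Proof. by rewrite -!natrD => ->. Qed.

Lemma low_natr x l : (low x l)%:R = x.
Proof. exact: natr_FpD. Qed.

Lemma high_natr x l : (high x l)%:R = x ^+ 2 - (w (low x l %% m))%:R.
Proof. exact: natr_FpD. Qed.

Lemma low_bound x l : (low x l < 24 * (p * m))%N.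
Proof. have := Fp_ltn x; have := ltn_ord l.1; rewrite /low; nia. Qed.

Lemma high_bound x l : (high x l < p * J)%N.
Proof.
rewrite /high; move: (x ^+ 2 - _ : 'F_p) => z.
by have := Fp_ltn z; have := ltn_ord l.2; nia.
Qed.

Lemma Fp2 : 2 != 0 :> 'F_p.
Proof. by rewrite natr_Fp_eq0; apply/negP => /dvdn_leq; lia. Qed.

Lemma Fp3 : 3 != 0 :> 'F_p.
Proof. by rewrite natr_Fp_eq0; apply/negP => /dvdn_leq; lia. Qed.

(** Two low digits add up to less than B, so the sum splits into the sums of low
    and of high digits.  The low sum fixes x1 + x2 modulo p and, modulo m, the sum
    of the weights; the high sum then fixes x1^2 + x2^2. *)
Lemma point_sidon x1 x2 x3 x4 l1 l2 l3 l4 :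
    allowed x1 l1 -> allowed x2 l2 -> allowed x3 l3 -> allowed x4 l4 ->
    (point x1 l1 + point x2 l2 = point x3 l3 + point x4 l4)%N ->
  (x1 = x3 /\ x2 = x4) \/ (x1 = x4 /\ x2 = x3).
Proof.
move=> a1 a2 a3 a4 e.
have [] := @eq_digits B (low x1 l1 + low x2 l2) (high x1 l1 + high x2 l2)
   (low x3 l3 + low x4 l4) (high x3 l3 + high x4 l4).
- by have := low_bound x1 l1; have := low_bound x2 l2; rewrite /B; lia.
- by have := low_bound x3 l3; have := low_bound x4 l4; rewrite /B; lia.
- by move: e; rewrite /point; lia.
move=> eL eH.
have eW := wD a1 a2 a3 a4.
rewrite !modnDml !modnDmr eL in eW; have {}eW := eW erefl.
have e1 : x1 + x2 = x3 + x4.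
  by have := eq_natFD eL; rewrite !low_natr.
apply: parabola_sidon Fp2 e1 _.
have := eq_natFD eH; rewrite !high_natr => e2.
have e3 := eq_natFD eW.
move: e2 e3; set r1 := (w _)%:R; set r2 := (w _)%:R.
set r3 := (w _)%:R; set r4 := (w _)%:R => e2 e3.
have -> : x1 ^+ 2 + x2 ^+ 2 = (x1 ^+ 2 - r1 + (x2 ^+ 2 - r2)) + (r1 + r2) by ring.
by rewrite e2 e3; ring.
Qed.

Lemma Fp_modn (x : 'F_p) n : n%:R = x -> (n %% p)%N = x.
Proof. by move=> <-; rewrite val_Fp_nat. Qed.

Lemma exists_lift (x : 'F_p) v h : (v < 24 * (p * m))%N -> (h < p * J)%N ->
    v%:R = x -> h%:R = x ^+ 2 - (w (v %% m))%:R ->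
  exists l, low x l = v /\ high x l = h.
Proof.
move=> vlt hlt vx hx.
have il : (v %/ p < 24 * m)%N by rewrite ltn_divLR //; lia.
have jl : (h %/ p < J)%N by rewrite ltn_divLR //; lia.
exists (Ordinal il, Ordinal jl).
have lE : low x (Ordinal il, Ordinal jl) = v.
  by rewrite /low -(Fp_modn vx) /= addnC mulnC -divn_eq.
by split=> //; rewrite /high lE -(Fp_modn hx) /= addnC mulnC -divn_eq.
Qed.

Lemma exists_low_lift (x : 'F_p) a lo : (a < m)%N ->
  exists v, [/\ (lo <= v < lo + p * m)%N, v%:R = x & (v %% m)%N = a].
Proof.
have pm0 : (0 < p * m)%N by rewrite muln_gt0 p0.
move=> am; have [v vlo vE] := exists_residue_in_window (chinese p m x a) lo pm0.
exists v; split=> //.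
  apply: val_inj; rewrite /= val_Fp_nat //.
  rewrite -(modn_dvdm _ (dvdn_mulr m (dvdnn p))) vE modn_dvdm ?dvdn_mulr //.
  by rewrite chinese_modl // modn_small // Fp_ltn.
rewrite -(modn_dvdm _ (dvdn_mull p (dvdnn m))) vE modn_dvdm ?dvdn_mull //.
by rewrite chinese_modr // modn_small.
Qed.

Lemma exists_high_lift (z : 'F_p) lo :
  exists2 h, (lo <= h < lo + p)%N & h%:R = z.
Proof.
have [h hlo hE] := exists_residue_in_window z lo p0.
exists h => //; apply: val_inj; rewrite /= val_Fp_nat // hE.
by rewrite modn_small // Fp_ltn.
Qed.

(** The first two lifts are chosen with digits close to V / 3 and W / 3 in the
    required residue classes; the digits of the third are then forced, and they
    lie in the right classes and in the right ranges. *)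
Lemma exists_lift_triple (V W : nat) (x1 x2 x3 : 'F_p) a1 a2 a3 :
    (12 * (p * m) <= V < 60 * (p * m))%N ->
    (6 * p <= W <= 3 * (p * J) - 6 * p)%N ->
    a1 \in D -> a2 \in D -> a3 \in D -> a1 + a2 + a3 = V %[mod m] ->
    x1 + x2 + x3 = V%:R ->
    x1 ^+ 2 + x2 ^+ 2 + x3 ^+ 2 = (W + (w a1 + w a2 + w a3))%:R ->
  exists l1 l2 l3, [/\ allowed x1 l1, allowed x2 l2, allowed x3 l3 &
    (point x1 l1 + point x2 l2 + point x3 l3 = V + B * W)%N].
Proof.
move=> Vb Wb d1 d2 d3 dV xV xW.
have p1 : (1 <= m)%N := m0.
have P6 : (3 <= p * m)%N by nia.
have [v1 [v1b v1x v1a]] := exists_low_lift x1 (V %/ 3) (Dm d1).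
have [v2 [v2b v2x v2a]] := exists_low_lift x2 (V %/ 3) (Dm d2).
have [h1 h1b h1x] := exists_high_lift (x1 ^+ 2 - (w a1)%:R) (W %/ 3).
have [h2 h2b h2x] := exists_high_lift (x2 ^+ 2 - (w a2)%:R) (W %/ 3).
have [v1s v2s v12s v3s] := third_near_third v1b v2b.
have [h1s h2s h12s h3s] := third_near_third h1b h2b.
have v3P : exists v3, (v1 + v2 + v3 = V)%N /\ (v3 < 24 * (p * m))%N.
  by exists (V - v1 - v2)%N; move: Vb v12s v3s P6; clear; lia.
have h3P : exists h3, (h1 + h2 + h3 = W)%N /\ (h3 < p * J)%N.
  by exists (W - h1 - h2)%N; move: Wb h12s h3s p3; clear; lia.
case: v3P => v3 [v3V v3b]; case: h3P => h3 [h3W h3b].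
have v3x : v3%:R = x3.
  have := eq_natF v3V; rewrite !natrD v1x v2x -xV.
  by move/addrI.
have v3a : (v3 %% m)%N = a3.
  rewrite -[RHS](modn_small (Dm d3)); apply/eqP.
  by rewrite -(eqn_modDl (a1 + a2)) dV -v3V eqn_modDr -v1a -v2a modnDm.
have h3x : h3%:R = x3 ^+ 2 - (w a3)%:R.
  have := eq_natF h3W; rewrite !natrD h1x h2x => e.
  move: xW; rewrite !natrD -e => e'.
  have -> : h3%:R = (x1 ^+ 2 - (w a1)%:R + (x2 ^+ 2 - (w a2)%:R) + h3%:R +
       ((w a1)%:R + (w a2)%:R + (w a3)%:R)) - x1 ^+ 2 - x2 ^+ 2 - (w a3)%:R by ring.
  by rewrite -e'; ring.
have v1l : (v1 < 24 * (p * m))%N by move: v1s Vb; clear; lia.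
have v2l : (v2 < 24 * (p * m))%N by move: v2s Vb; clear; lia.
have h1l : (h1 < p * J)%N by move: h1s Wb; clear; lia.
have h2l : (h2 < p * J)%N by move: h2s Wb; clear; lia.
rewrite -v1a in h1x; rewrite -v2a in h2x; rewrite -v3a in h3x.
have [l1 [lo1 hi1]] := exists_lift v1l h1l v1x h1x.
have [l2 [lo2 hi2]] := exists_lift v2l h2l v2x h2x.
have [l3 [lo3 hi3]] := exists_lift v3b h3b v3x h3x.
exists l1, l2, l3; rewrite /allowed /point lo1 lo2 lo3 hi1 hi2 hi3 v1a v2a v3a.
by split=> //; rewrite -v3V -h3W !mulnDr; clear; lia.
Qed.

Hypotheses (N1 : (1 < N)%N) (J15 : (15 <= J)%N)
  (NJ : (96 * m * p ^ 2 * J <= N < 96 * m * p ^ 2 * J.+1)%N).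

(** The N consecutive integers from 7 p B on represent all residues modulo N.
    When the low digit of such an integer is too small to be a sum of three
    digits near its third, one unit of the high digit is carried down.  The
    quotients by B fill an interval of length about 2 p J, and J >= 15 leaves
    room for it between 6 p and 3 p J - 6 p. *)
Lemma exists_target_digits (Y : 'Z_N) : exists V W,
  [/\ (12 * (p * m) <= V < 60 * (p * m))%N,
      (6 * p <= W <= 3 * (p * J) - 6 * p)%N &
      (V + B * W)%N%:R = Y].
Proof.
have [y yb yE] := @exists_residue_in_window N Y (7 * p * B) (ltnW N1).
have yY : y%:R = Y.
  apply: val_inj; rewrite /= val_Zp_nat // yE modn_small //.
  by rewrite -[X in (_ < X)%N](Zp_cast N1) ltn_ord.
have B0 : (0 < B)%N by rewrite /B !muln_gt0 p0 m0.
have yd := divn_eq y B; have yr := ltn_pmod y B0.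
have Wlo : (7 * p <= y %/ B)%N by rewrite leq_divRL //; case/andP: yb.
have Whi : (y %/ B < 9 * p + 2 * (p * J))%N.
  rewrite ltn_divLR //; case/andP: yb => _ yN; case/andP: NJ => _ NB.
  by apply: leq_trans yN _; move: NB; rewrite /B -mulnn; clear; lia.
have [Vlo|Vhi] := leqP (12 * (p * m)) (y %% B).
  exists (y %% B)%N, (y %/ B)%N; split; last by rewrite addnC mulnC -yd.
    by move: Vlo yr; rewrite /B; clear; lia.
  by move: Wlo Whi J15 p3; clear; nia.
exists (y %% B + B)%N, (y %/ B).-1; split.
- by move: Vhi; rewrite /B; clear; lia.
- by move: Wlo Whi J15 p3; clear; nia.
rewrite -addnA -mulnS prednK; first by rewrite addnC mulnC -yd.
by move: Wlo p3; clear; lia.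
Qed.

Definition represents (Y : 'Z_N) (c : seq ('F_p * lift_index)) :=
  exists e1 e2 e3, [/\ c = [:: e1; e2; e3], all (fun e => allowed e.1 e.2) c &
    (point e1.1 e1.2 + point e2.1 e2.2 + point e3.1 e3.2)%N%:R = Y].

Hypotheses (w2 : two_triple_weights m D w) (wp : forall a, (3 * w a < p)%N).

(** Of the two weights available for the residue of V modulo m, at least one makes
    the conic nondegenerate, since they differ modulo p. *)
Lemma exists_representations (Y : 'Z_N) t : (18 * t + 10 <= p)%N ->
  exists E, [/\ size E = t, uniq (unzip1 (flatten E)) &
    forall c, c \in E -> represents Y c].
Proof.
move=> tp.
have wlt r : (triple_weight w r < p)%N.
  have := wp r.1.1; have := wp r.1.2; have := wp r.2.
  by rewrite /triple_weight; clear; lia.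
have [V [W [Vb Wb VWY]]] := exists_target_digits Y.
have [[[a1 a2] a3] [/and4P[d1 d2 d3 /eqP dV] ne]] : exists r : nat * nat * nat,
    triple_of_sum m D V r /\ 3 * (W + triple_weight w r)%:R != V%:R ^+ 2 :> 'F_p.
  have [r [r' [rV r'V ne]]] := w2 V.
  have [e|ne'] := eqVneq (3 * (W + triple_weight w r)%:R) (V%:R ^+ 2 : 'F_p).
  2: by exists r.
  exists r'; split=> //; rewrite -e; apply: contra ne.
  rewrite (natrD _ W) (natrD _ W) => /eqP/(mulfI Fp3)/addrI/(congr1 val).
  by rewrite /= !val_Fp_nat // !modn_small // => ->.
have [|T [sT uT TP]] := disjoint_solution_triples Fp2 Fp3 ne (t := t).
  by rewrite card_Fp.
have [|E ET EP] := @map_preimage _ _ unzip1 (represents Y) T.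
  move=> s /TP[x1 [x2 [x3 [-> xV xW]]]].
  have [l1 [l2 [l3 [g1 g2 g3 e]]]] :=
    exists_lift_triple Vb Wb d1 d2 d3 dV xV xW.
  exists [:: (x1, l1); (x2, l2); (x3, l3)] => //.
  exists (x1, l1), (x2, l2), (x3, l3); split=> //=; first by rewrite g1 g2 g3.
  by rewrite e.
exists E; split=> //; first by rewrite -sT -ET size_map.
by rewrite /unzip1 map_flatten [map _ E]ET.
Qed.

Definition lifted_parabola (f : {ffun 'F_p -> lift_index}) : {set 'Z_N} :=
  [set (point x (f x))%:R | x : 'F_p & allowed x (f x)].

(** This keeps the sums of two lifts from wrapping around modulo N. *)
Lemma point_bound x l : (2 * point x l < N)%N.
Proof.
have := low_bound x l; have := high_bound x l; case/andP: NJ.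
rewrite /point /B; move: (low x l) (high x l) => a h; clear; nia.
Qed.

Lemma sidon_lifted_parabola f : sidon (lifted_parabola f).
Proof.
move=> _ _ _ _ /imsetP[x1 + ->] /imsetP[x2 + ->] /imsetP[x3 + ->] /imsetP[x4 + ->].
rewrite !inE => g1 g2 g3 g4.
rewrite -!natrD => /(congr1 val); rewrite /= !val_Zp_nat //.
rewrite !modn_small; first last.
- by have := point_bound x1 (f x1); have := point_bound x2 (f x2); lia.
- by have := point_bound x3 (f x3); have := point_bound x4 (f x4); lia.
move=> e z; rewrite !inE.
by have [[-> ->]|[-> ->]] := point_sidon g1 g2 g3 g4 e; rewrite // orbC.
Qed.

Lemma basis_lifted_parabola t : (18 * t + 10 <= p)%N ->
    (N * ((24 * m * J) ^ 3 - 1) ^ t < ((24 * m * J) ^ 3) ^ t)%N ->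
  exists f, basis_of_order3 (lifted_parabola f).
Proof.
move=> tp lt.
have [E EP] := fin_all_exists (fun Y => exists_representations Y tp).
have cL : #|{: lift_index}| = (24 * m * J)%N by rewrite card_prod !card_ord.
have [|||||f fP] := @exists_hitting 'F_p lift_index 'Z_N E 3 t.
- by rewrite cL !muln_gt0 m0 (leq_trans _ J15).
- by move=> Y c; have [_ _ /(_ c) H] := EP Y; move=> /H[e1 [e2 [e3 [-> _ _]]]].
- by move=> Y; have [] := EP Y.
- by move=> Y; have [] := EP Y.
- by rewrite cL card_ord Zp_cast.
exists f => Y; have [c cE] := fP Y; have [_ _ /(_ _ cE)] := EP Y.
move=> [e1 [e2 [e3 [-> /and4P[g1 g2 g3 _] <-]]]] /and4P[/eqP f1 /eqP f2 /eqP f3 _].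
exists (point e1.1 e1.2)%:R, (point e2.1 e2.2)%:R, (point e3.1 e3.2)%:R.
split; last by rewrite !natrD.
- by apply/imsetP; exists e1.1; rewrite ?inE f1.
- by apply/imsetP; exists e2.1; rewrite ?inE f2.
- by apply/imsetP; exists e3.1; rewrite ?inE f3.
Qed.
End Lifts.

(* 'Z_N is the ring of integers mod N only when 1 < N. *)
Theorem theorem1p1 :
  exists N0 : nat, forall N : nat, (1 < N)%N -> (N0 <= N)%N ->
    exists S : {set 'Z_N}, sidon S /\ basis_of_order3 S.
Proof.
have [N0 N0P] := @exists_parameters 183 isT.
have m0 : (0 < 183)%N by [].
exists N0 => N N1 /N0P[p [J [t [pr pbig J15 NJ [tp lt]]]]].
have p3 : (3 < p)%N by move: pbig; clear; lia.
have pm : coprime p 183.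
  rewrite prime_coprime //; apply/negP => /dvdn_leq; move: pbig; clear; lia.
have Dm a : a \in singer -> (a < 183)%N.
  by apply: (allP (isT : all (fun a => a < 183)%N singer)).
have wp a : (3 * weight a < p)%N.
  have : (weight a <= 3)%N.
    rewrite /weight; set ws := (X in nth _ X _).
    have [i_lt|?] := ltnP (index a singer) (size ws); last by rewrite nth_default.
    exact: (all_nthP 0 (isT : all (fun c => c <= 3)%N ws)).
  by move: pbig; clear; lia.
have [f fB] := basis_lifted_parabola pr p3 m0 pm Dm N1 J15 NJ weight_two_triples
  wp tp lt.
exists (lifted_parabola N singer weight f); split=> //.
exact: (sidon_lifted_parabola pr p3 m0 pm weight_additive).
Qed.
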